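(* Let $f$ be a Boolean function with triples table $T$, and let $C$ be a positive additive cost function. Let $A$ be an Ancestor Set with respect to $T$, let $PS$ be its primeset, and let $RS$ be the set of primes of $f$ that are not covered by the union of the Essential primes with $PS$. Then every minimum-cost basis for $f$ (with respect to $C$) consists of the Essential primes, a minimum-cost subset of $PS$ that covers $PS$, and a minimum-cost subset of $RS$ that covers $RS$.
   Context: $f:\{0,1\}^n\to\{0,1\}$ is a Boolean function. Products are conjunctions of literals $x_i,x_i'$; a prime is an implicant of $f$ that ceases to be an implicant when any literal is removed. If products $U,V$ have exactly one reversal variable ($x$ in one, $x'$ in the other), $(U\circ V)$ is the product of their remaining literals; $\mathrm{Consensus}(S)$ is $S$ with all products generated by repeated valid consensus; $Y$ is covered by $S$ if $Y\in\mathrm{Consensus}(S)$. A basis is a set of primes whose OR equals $f$. A cost function assigns a positive cost to each product and is additive (the cost of a set is the sum of the costs). Essential primes are primes not covered by the other primes; $\langle Free\rangle=\mathrm{Consensus}(\text{Essentials})$; products of $\mathrm{Consensus}(\text{all primes})$ not in $\langle Free\rangle$ are non-free, indexed $X_1,X_2,\dots$. The triples table $T$ is a set of index triples $(r,i,j)$, $j\ge0$, meaning ''if $X_i$ and (when $j>0$) $X_j$ are covered then $X_r$ is covered'' (index $0$ = a free product); it contains $(r,i,j)$ for each consensus $X_r=(X_i\circ X_j)$ of non-free products with $X_r$ non-free, $(r,i,0)$ for each consensus of non-free $X_i$ with a free product giving non-free $X_r$, and $(r,k,0)$ for each non-free $X_r\in\mathrm{Consensus}(\langle Free\rangle\cup\{X_k\})$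 for certain non-free primes $X_k$; useless entries $(r,i,j)$, $j>0$, with $(r,i,0)$ or $(r,j,0)$ present are removed, and entries whose first index never occurs in a second/third position are repeatedly removed. For $(r,i,0)\in T$, $i$ is a parent of $r$; for $(r,i,j)\in T$, $j>0$, $i$ and $j$ are parents of $r$. $Anc(r)$ is the set of parents of $r$, parents of parents, etc., iterated until no new indices appear; an Ancestor Set is a set of this form. The primeset of an Ancestor Set is the set of primes belonging to it. A set of primes covers a set of primes $PS$ if every member of $PS$ is covered (via the covering relationships of the table, equivalently via consensus together with the free products) by that set.
   Formalization: ''Covers RS'' is taken with the Essential primes and PS already covered, not just the free products; with only the free products available the claim fails, e.g. for f = ab'+bc'+ca'+a'b'c'x with unit costs. *)

(* Defs.v *)
From HB Require Import structures.
From mathcomp Require Import all_boot all_order all_algebra.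

Set Implicit Arguments.
Unset Strict Implicit.
Unset Printing Implicit Defensive.

Import Order.TTheory GRing.Theory Num.Theory.

Definition point (n : nat) := {ffun 'I_n -> bool}.

(* A conjunction of literals: [p i] is [Some true] if the literal x_i occurs,   *)
(* [Some false] if x_i' occurs, [None] if the variable i is absent; the constant *)
(* function [None] is the empty product 1.                                       *)
Definition product (n : nat) := {ffun 'I_n -> option bool}.

Section Products.
Variable n : nat.
Implicit Types (p U V Y : product n) (S Z B : {set product n}) (x : point n).

Definition sat p x : bool := [forall i, (p i == None) || (p i == Some (x i))].

Definition drop_literal p (i : 'I_n) : product n :=
  [ffun k => if k == i then None else p k].

Definition reversals U V : {set 'I_n} :=
  [set i | [&& U i != None, V i != None & U i != V i]].

Definition valid_consensus U V : bool := #|reversals U V| == 1%N.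

(* Only meaningful when [valid_consensus U V]. *)
Definition consensus U V : product n :=
  [ffun i => if i \in reversals U V then None
             else if U i == None then V i else U i].

Definition consensus_closed Z : bool :=
  [forall U in Z, forall V in Z, valid_consensus U V ==> (consensus U V \in Z)].

Definition Consensus S : {set product n} :=
  \bigcap_(Z : {set product n} | (S \subset Z) && consensus_closed Z) Z.

Variable f : point n -> bool.

Definition implicant p : bool := [forall x, sat p x ==> f x].

Definition prime_implicant p : bool :=
  implicant p && [forall i, (p i != None) ==> ~~ implicant (drop_literal p i)].

Definition prime_implicants : {set product n} := [set p | prime_implicant p].

Definition basis B : Prop :=
  B \subset prime_implicants /\ forall x, [exists p in B, sat p x] = f x.

Definition Essentials : {set product n} :=
  [set p in prime_implicants | p \notin Consensus (prime_implicants :\ p)].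

Definition Free : {set product n} := Consensus Essentials.

Definition nonfree : {set product n} := Consensus prime_implicants :\: Free.

End Products.

(* [X] numbers the non-free products, each exactly once. *)
Definition nonfree_indexing n (f : point n -> bool) m (X : 'I_m -> product n)
  : Prop := injective X /\ [set X i | i : 'I_m] = nonfree f.

(* (r, i, Some j) stands for the triple (r, i, j) with j > 0, and (r, i, None)   *)
(* for (r, i, 0).                                                                *)
Definition triple (m : nat) : Type := ('I_m * 'I_m * option 'I_m)%type.

Section Table.
Variables (n : nat) (f : point n -> bool) (m : nat) (X : 'I_m -> product n).
Implicit Types (T : {set triple m}) (r i : 'I_m) (A : {set 'I_m}).

(* [K] is the set of indices k of the non-free primes for which the triples      *)
(* (r, k, 0) with X_r in Consensus(Free + X_k) are put in the table.             *)
Definition initial_table (K : {set 'I_m}) : {set triple m} :=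
  [set t : triple m |
    let: (r, i, oj) := t in
    match oj with
    | Some j => valid_consensus (X i) (X j) && (consensus (X i) (X j) == X r)
    | None =>
        [exists F in Free f,
           valid_consensus (X i) F && (consensus (X i) F == X r)]
        || (i \in K) && (X r \in Consensus (X i |: Free f))
    end].

Definition remove_useless T : {set triple m} :=
  [set t in T |
    let: (r, i, oj) := t in
    if oj is Some j then ((r, i, None) \notin T) && ((r, j, None) \notin T)
    else true].

Definition parent T : rel 'I_m := fun r i =>
  [exists t in T, (t.1.1 == r) && ((t.1.2 == i) || (t.2 == Some i))].

Definition prune T : {set triple m} :=
  [set t in T | [exists r, parent T r t.1.1]].

(* Each pruning step that changes the table removes at least one triple, so      *)
(* [#|T|] steps reach the stable table.                                          *)
Definition triples_table (K : {set 'I_m}) : {set triple m} :=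
  let T := remove_useless (initial_table K) in iter #|T| prune T.

Definition Anc T r : {set 'I_m} :=
  [set i | [exists j, parent T r j && connect (parent T) j i]].

Definition ancestor_set T A : Prop := exists r, A = Anc T r.

Definition primeset A : {set product n} :=
  [set X i | i in A & prime_implicant f (X i)].

End Table.

Section Costs.
Variables (n : nat) (R : realFieldType) (C : product n -> R).
Implicit Types (F P Q B : {set product n}).

Definition cost B : R := (\sum_(p in B) C p)%R.

Definition minimum_cost_basis (f : point n -> bool) B : Prop :=
  basis f B /\ forall B', basis f B' -> (cost B <= cost B')%R.

(* Every member of P is covered by Q, the products of F being available for      *)
(* free. For the primeset PS of an ancestor set, F is [Free f]; for the remaining *)
(* primes RS, what is already covered by the essential primes and PS is free too: *)
(* F is Consensus(Essentials + PS), the very set used to define RS. With         *)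
(* F := Free f for RS the decomposition fails: for                               *)
(* f = ab' + bc' + ca' + a'b'c'x, PS consists of the six primes without x and    *)
(* RS = {a'x, b'x, c'x}; any one of these three covers the other two together    *)
(* with PS, but not without it.                                                  *)
Definition covers F Q P : Prop := P \subset Consensus (F :|: Q).

Definition minimum_cost_cover F P Q : Prop :=
  [/\ Q \subset P, covers F Q P &
      forall Q', Q' \subset P -> covers F Q' P -> (cost Q <= cost Q')%R].

End Costs.

(* Main.v *)
(* For primes, being generated by consensus is the same as being implied, so a  *)
(* set of primes is a basis iff its consensus closure contains every prime.     *)
(* Since an ancestor set A is closed under parents, a derivation of a member of *)
(* PS from a set B of primes never has to leave A: B :&: PS and the free        *)
(* products already cover PS. Hence in a minimum-cost basis the parts inside    *)
(* and outside PS can be exchanged independently.                               *)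
Require Import Defs.
From HB Require Import structures.
From mathcomp Require Import all_boot all_order all_algebra.

Set Implicit Arguments.
Unset Strict Implicit.
Unset Printing Implicit Defensive.

Import Order.TTheory GRing.Theory Num.Theory.
Local Open Scope ring_scope.

(** Two facts carry the proof. First, consensus is complete: a product implied by the OR of [S] lies
    below a member of [Consensus S] ([Consensus_complete]), and for a prime this member is the prime
    itself ([prime_covered]). Hence replacing a part of a minimum-cost basis [B] by primes [Q] that
    keep all of [B] covered gives a basis again, so [Q] costs at least as much as that part
    ([minimum_cost_basis_exchange]). Second, ancestor sets are local: the free products and
    [B :&: PS] alone cover [PS] ([Consensus_ancestor_set]). So [B] splits into the essentials,
    [B :&: PS] and a rest. An exchange in each of the last two parts gives its minimality. The rest
    lies in [RS], since a minimum-cost basis has no member covered by the others. *)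

(** * Soundness and completeness of consensus *)

Section ConsensusTheory.
Variable n : nat.
Implicit Types (p U V W Y : product n) (S Z : {set product n}) (x : point n).

Lemma satP p x : reflect (forall i, p i = None \/ p i = Some (x i)) (sat p x).
Proof.
by apply: (iffP forallP) => h i; have := h i;
  [move=> /orP[] /eqP; auto | move=> [] ->; rewrite eqxx ?orbT].
Qed.

Lemma reversalsC U V : reversals U V = reversals V U.
Proof. by apply/setP => i; rewrite !inE [U i == V i]eq_sym andbCA. Qed.

Lemma valid_consensusC U V : valid_consensus U V = valid_consensus V U.
Proof. by rewrite /valid_consensus reversalsC. Qed.

Lemma consensusC U V : consensus U V = consensus V U.
Proof.
apply/ffunP => i; rewrite !ffunE (reversalsC V U).
case: ifP => // /negbT; rewrite inE.
by case: (U i) (V i) => [a|] [b|] //= /negPn/eqP.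
Qed.

(** Off the reversal variable [x] agrees with both products; at it, the value of [x] satisfies the
    literal of one of them. *)
Lemma sat_consensus U V x : valid_consensus U V ->
  sat (consensus U V) x -> sat U x || sat V x.
Proof.
move=> /cards1P[i rev_i] /satP sat_c; apply/orP.
have Uni k : k != i -> U k = None \/ U k = Some (x k).
  by move=> ki; have := sat_c k; rewrite ffunE rev_i inE (negPf ki);
    case: eqP; auto.
have Vni k : k != i -> V k = None \/ V k = Some (x k).
  move=> ki; have := sat_c k; rewrite consensusC ffunE reversalsC rev_i inE.
  by rewrite (negPf ki); case: eqP; auto.
have : i \in reversals U V by rewrite rev_i inE.
rewrite inE => /and3P[].
case Ui: (U i) => [a|] //; case Vi: (V i) => [b|] // _ _ neq_ab.
case: (eqVneq a (x i)) => [eq_a|neq_a].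
  left; apply/satP => k; have [->|/Uni //] := eqVneq k i.
  by rewrite Ui eq_a; right.
right; apply/satP => k; have [->|/Vni //] := eqVneq k i.
by rewrite Vi; right; case: a b (x i) neq_ab neq_a {Ui Vi} => [] [] [].
Qed.

Lemma consensus_closedP Z :
  reflect (forall U V, U \in Z -> V \in Z -> valid_consensus U V ->
             consensus U V \in Z)
          (consensus_closed Z).
Proof.
apply: (iffP forall_inP) => [h U V UZ VZ|h U UZ].
  by move/forall_inP/(_ _ VZ)/implyP: (h U UZ).
by apply/forall_inP => V VZ; apply/implyP; apply: h.
Qed.

Lemma sub_Consensus S : S \subset Consensus S.
Proof. by apply/bigcapsP => Z /andP[]. Qed.

Lemma Consensus_min S Z :
  S \subset Z -> consensus_closed Z -> Consensus S \subset Z.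
Proof. by move=> SZ clZ; apply: bigcap_inf; rewrite SZ. Qed.

Lemma Consensus_closed S : consensus_closed (Consensus S).
Proof.
apply/consensus_closedP => U V /bigcapP US /bigcapP VS valUV.
apply/bigcapP => Z hZ; have /andP[_ /consensus_closedP clZ] := hZ.
by apply: clZ => //; [apply: US | apply: VS].
Qed.

Lemma Consensus_subP S Z :
  (Consensus S \subset Consensus Z) = (S \subset Consensus Z).
Proof.
apply/idP/idP => [|SZ]; first exact: subset_trans (sub_Consensus S).
exact: Consensus_min (Consensus_closed Z).
Qed.

Lemma ConsensusS S Z : S \subset Z -> Consensus S \subset Consensus Z.
Proof.
by move=> SZ; rewrite Consensus_subP (subset_trans SZ) ?sub_Consensus.
Qed.

Lemma Consensus_sound S p x :
  p \in Consensus S -> sat p x -> [exists q in S, sat q x].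
Proof.
have clZ : consensus_closed [set q | sat q x ==> [exists q in S, sat q x]].
  apply/consensus_closedP => U V; rewrite !inE => /implyP hU /implyP hV val.
  by apply/implyP => /(sat_consensus val)/orP[/hU|/hV].
have sZ : S \subset [set q | sat q x ==> [exists q in S, sat q x]].
  apply/subsetP => q qS; rewrite inE; apply/implyP => sq.
  by apply/exists_inP; exists q.
by move/(subsetP (Consensus_min sZ clZ)); rewrite inE => /implyP.
Qed.

Definition implies_product Y W : bool :=
  [forall i, (W i == None) || (W i == Y i)].

Lemma implies_productP Y W :
  reflect (forall i, W i = None \/ W i = Y i) (implies_product Y W).
Proof.
by apply: (iffP forallP) => h i; have := h i;
  [move=> /orP[] /eqP; auto | move=> [] ->; rewrite eqxx ?orbT].
Qed.

Lemma implies_product_sat Y W x :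
  implies_product Y W -> sat Y x -> sat W x.
Proof.
move=> /implies_productP YW /satP sY; apply/satP => i.
by case: (YW i) => ->; auto.
Qed.

Definition add_literal Y (i : 'I_n) (b : bool) : product n :=
  [ffun k => if k == i then Some b else Y k].

Lemma sat_add_literal Y i b x :
  Y i = None -> sat (add_literal Y i b) x -> sat Y x.
Proof.
move=> Yi /satP sY; apply/satP => k; have := sY k; rewrite ffunE.
by case: eqP => // ->; left.
Qed.

(* Split Y on an absent variable i: the two halves are below products W1, W0 of *)
(* the closure, and either one of them omits i or their consensus does.         *)
Lemma Consensus_complete S Y :
  (forall x, sat Y x -> [exists q in S, sat q x]) ->
  exists2 W, W \in Consensus S & implies_product Y W.
Proof.
have [k] := ubnP #|[set i | Y i == None]|; elim: k Y => // k IHk Y ltYk cov.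
have [Y0|[i]] := set_0Vmem [set i | Y i == None].
  have YS i : Y i != None by move/setP/(_ i): Y0; rewrite !inE => ->.
  (* [Y] is a minterm and [x] its only point; the default [true] never occurs. *)
  pose x : point n := [ffun i => odflt true (Y i)].
  have Yx i : Y i = Some (x i) by rewrite ffunE; case: (Y i) (YS i).
  have /exists_inP[q qS /satP sq] : [exists q in S, sat q x].
    by apply: cov; apply/satP; auto.
  exists q; first exact: (subsetP (sub_Consensus S)).
  by apply/implies_productP => i; rewrite Yx.
rewrite inE => /eqP Yi.
have half b : exists2 W, W \in Consensus S &
    implies_product (add_literal Y i b) W.
  apply: IHk => [|x /sat_add_literal-/(_ Yi)]; last exact: cov.
  rewrite -ltnS; apply: leq_trans ltYk; rewrite ltnS.
  apply: proper_card; apply/properP; split.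
    apply/subsetP => j; rewrite !inE ffunE.
    by case: (j == i).
  by exists i; rewrite !inE ?Yi // ffunE eqxx.
have [W1 W1S /implies_productP W1Y] := half true.
have [W0 W0S /implies_productP W0Y] := half false.
have lit b W :
    (forall j, W j = None \/ W j = add_literal Y i b j) ->
    (forall j, j != i -> W j = None \/ W j = Y j)
      /\ (W i = None \/ W i = Some b).
  move=> h; split=> [j ji|]; first by have := h j; rewrite ffunE (negPf ji).
  by have := h i; rewrite ffunE eqxx.
have [W1n [W1i|W1i]] := lit _ _ W1Y.
  exists W1 => //; apply/implies_productP => j.
  by have [->|/W1n //] := eqVneq j i; left.
have [W0n [W0i|W0i]] := lit _ _ W0Y.
  exists W0 => //; apply/implies_productP => j.
  by have [->|/W0n //] := eqVneq j i; left.
(* Away from [i] all literals of [W1] and [W0] come from [Y], so they cannot conflict there. *)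
have rev10 : reversals W1 W0 = [set i].
  apply/setP => j; rewrite !inE; have [->|ji] := eqVneq j i.
    by rewrite W1i W0i.
  by case: (W1n j ji) (W0n j ji) => -> [] -> //=; rewrite ?eqxx !andbF.
exists (consensus W1 W0).
  apply: (consensus_closedP _ (Consensus_closed S)) => //.
  by rewrite /valid_consensus rev10 cards1.
apply/implies_productP => j; rewrite ffunE rev10 inE.
have [->|ji] := eqVneq j i; first by left.
by case: ifP => _; [apply: W0n | apply: W1n].
Qed.

End ConsensusTheory.

(** * Bases as covering sets of primes *)

Section Bases.
Variables (n : nat) (f : point n -> bool).
Implicit Types (p : product n) (S B : {set product n}) (x : point n).

Let primes := prime_implicants f.

Lemma primes_sat p x : p \in primes -> sat p x -> f x.
Proof. by rewrite inE => /andP[/forallP/(_ x)/implyP]. Qed.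

(** Completeness gives a member of the closure whose literals are among those of [p]. If it lacked
    one, [p] without that literal would still imply [f], against primality. *)
Lemma prime_covered S p : S \subset primes -> p \in primes ->
  (forall x, sat p x -> [exists q in S, sat q x]) -> p \in Consensus S.
Proof.
move=> Sprimes; rewrite inE => /andP[_ /forallP pmin].
move=> /Consensus_complete[Z ZS pZ]; suff <- : Z = p by [].
apply/ffunP => i; have [Zi|//] := implies_productP _ _ pZ i.
case pi: (p i) => [a|]; last by rewrite Zi.
have /implyP := pmin i; rewrite pi => /(_ isT)/negP[].
apply/forallP => x; apply/implyP => sx.
have /exists_inP[q qS sq] : [exists q in S, sat q x].
  apply: (Consensus_sound ZS); apply: implies_product_sat sx.
  apply/implies_productP => j; rewrite ffunE; case: eqP => [->|_].
    by left.
  exact: (implies_productP _ _ pZ).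
exact: primes_sat (subsetP Sprimes _ qS) sq.
Qed.

Lemma basis_primes_covered B : basis f B -> primes \subset Consensus B.
Proof.
move=> [Bprimes Bf]; apply/subsetP => p pp.
by apply: prime_covered => // x /(primes_sat pp); rewrite Bf.
Qed.

Lemma basis_exchange B B' : basis f B ->
  B' \subset primes -> B \subset Consensus B' -> basis f B'.
Proof.
move=> [_ Bf] B'primes BB'; split=> // x; apply/idP/idP.
  by case/exists_inP => p /(subsetP B'primes)/primes_sat; apply.
rewrite -Bf => /exists_inP[p /(subsetP BB') pB' sp].
exact: Consensus_sound pB' sp.
Qed.

Lemma Essentials_primes : Essentials f \subset primes.
Proof. by apply/subsetP => p; rewrite inE => /andP[]. Qed.

Lemma Essentials_free : Essentials f \subset Free f.
Proof. exact: sub_Consensus. Qed.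

(** A basis without the prime [p] consists of other primes and yet covers [p], so [p] is not
    essential. *)
Lemma Essentials_sub_basis B : basis f B -> Essentials f \subset B.
Proof.
move=> Bbasis; apply/subsetP => p; rewrite inE => /andP[pp].
apply: contraR => pB; have := subsetP (basis_primes_covered Bbasis) p pp.
apply/subsetP/ConsensusS; apply/subsetP => q qB.
rewrite in_setD1 (subsetP Bbasis.1 q qB) andbT.
by apply: contraNneq pB => <-.
Qed.

Lemma Free_setU S :
  Consensus (Free f :|: S) = Consensus (Essentials f :|: S).
Proof.
apply/eqP; rewrite eqEsubset; apply/andP; split; last first.
  by apply/ConsensusS/setSU; apply: Essentials_free.
rewrite Consensus_subP subUset ConsensusS ?subsetUl //.
exact: subset_trans (subsetUr _ _) (sub_Consensus _).
Qed.

End Bases.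

(** * Locality of ancestor sets in the triples table *)

Section TableTheory.
Variables (n : nat) (f : point n -> bool) (m : nat) (X : 'I_m -> product n).
Implicit Types (T : {set triple m}) (A K : {set 'I_m}) (B : {set product n}).

Lemma parentP T r i :
  reflect (exists i' oj, (r, i', oj) \in T /\ (i' = i \/ oj = Some i))
          (parent T r i).
Proof.
apply: (iffP exists_inP) => [[[[r' i'] oj] tT /= /andP[/eqP <- h]]|].
  by exists i', oj; split=> //; case/orP: h => /eqP; auto.
move=> [i' [oj [tT h]]]; exists (r, i', oj) => //=; rewrite eqxx /=.
by case: h => ->; rewrite eqxx ?orbT.
Qed.

Lemma prune_parent T r i : parent (prune T) r i -> parent T r i.
Proof.
move=> /parentP[i' [oj [tT h]]]; apply/parentP; exists i', oj; split=> //.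
by move: tT; rewrite inE => /andP[].
Qed.

(** Pruning never creates parents, so a first index that is a parent after [k] rounds was one in
    every earlier round, and [t] was never deleted. *)
Lemma mem_iter_prune k T t r :
  t \in T -> parent (iter k (@prune m) T) r t.1.1 ->
  t \in iter k (@prune m) T.
Proof.
move=> tT; elim: k => //= k IHk /prune_parent par.
by rewrite inE (IHk par); apply/existsP; exists r.
Qed.

Lemma Anc_parent T r i j : i \in Anc T r -> parent T i j -> j \in Anc T r.
Proof.
rewrite !inE => /existsP[k /andP[rk ki]] ij; apply/existsP; exists k.
by rewrite rk (connect_trans ki) ?connect1.
Qed.

Lemma Anc_is_parent T r i : i \in Anc T r -> exists k, parent T k i.
Proof.
rewrite inE => /existsP[j /andP[rj /connectP[p pth ->]]].
case/lastP: p pth => [_|p k]; first by exists r.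
by rewrite rcons_path last_rcons => /andP[_ pk]; exists (last j p).
Qed.

(* Pruning only deletes triples whose first index is nobody's parent, hence no  *)
(* triple whose first index lies in an ancestor set.                            *)
Lemma ancestor_set_parents K A r i oj :
  ancestor_set (triples_table f X K) A -> r \in A ->
  (r, i, oj) \in remove_useless (initial_table f X K) ->
  i \in A /\ (forall j, oj = Some j -> j \in A).
Proof.
move=> [s ->] rA tT; have [k par] := Anc_is_parent rA.
have tTT := mem_iter_prune tT par.
split=> [|j ojj]; apply: (Anc_parent rA); apply/parentP; exists i, oj; auto.
Qed.

Lemma initial_table_NoneP K r i :
  (r, i, None) \in initial_table f X K ->
  X r \in Consensus (Free f :|: [set X i]).
Proof.
have FS : Free f \subset Consensus (Free f :|: [set X i]).
  exact: subset_trans (subsetUl _ _) (sub_Consensus _).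
have XS : X i \in Consensus (Free f :|: [set X i]).
  by apply: (subsetP (sub_Consensus _)); rewrite !inE eqxx orbT.
rewrite inE => /orP[/exists_inP[F FF /andP[valF /eqP <-]]|/andP[_]].
  exact: (consensus_closedP _ (Consensus_closed _)) (subsetP FS _ FF) valF.
by rewrite setUC.
Qed.

(** The invariant of a derivation from the essentials and [B] is that every product indexed in [A]
    lies in [G]. A consensus producing such a product is recorded in the table, and the parents
    recorded there are again in [A]. *)
Lemma Consensus_ancestor_set K A B :
  nonfree_indexing f X -> ancestor_set (triples_table f X K) A ->
  B \subset prime_implicants f ->
  Consensus (Essentials f :|: B) :&: primeset f X A
    \subset Consensus (Free f :|: B :&: primeset f X A).
Proof.
move=> [Xinj Ximg] Aanc Bprimes.
set G := Consensus (Free f :|: _).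
have FG : Free f \subset G.
  exact: subset_trans (subsetUl _ _) (sub_Consensus _).
have clG := consensus_closedP _ (Consensus_closed _ : consensus_closed G).
have clF := consensus_closedP _ (Consensus_closed _ : consensus_closed (Free f)).
have clAll := consensus_closedP _ (Consensus_closed (prime_implicants f)).
pose Z := [set p in Consensus (prime_implicants f) |
             [forall i in A, (X i == p) ==> (p \in G)]].
have ZP p : reflect (p \in Consensus (prime_implicants f) /\
                     forall i, i \in A -> X i = p -> p \in G) (p \in Z).
  rewrite inE; apply: (iffP andP) => -[pc h]; split=> //.
    by move=> i iA /eqP Xi; move/forall_inP/(_ i iA)/implyP: h; apply.
  by apply/forall_inP => i iA; apply/implyP => /eqP; apply: h.
suff sZ : Consensus (Essentials f :|: B) \subset Z.
  apply/subsetP => p /setIP[/(subsetP sZ)/ZP[_ h]] /imsetP[i].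
  by rewrite inE => /andP[iA _] pX; apply: (h i).
apply: Consensus_min.
  rewrite subUset; apply/andP; split; apply/subsetP => p pS; apply/ZP; split.
  - apply: (subsetP (sub_Consensus _)).
    exact: (subsetP (Essentials_primes f)).
  - by move=> _ _ _; apply/(subsetP FG)/(subsetP (Essentials_free f)).
  - exact/(subsetP (sub_Consensus _))/(subsetP Bprimes).
  - move=> i iA Xi; apply: (subsetP (sub_Consensus _)).
    rewrite !inE pS orbC /=; apply/orP; left; apply/imsetP; exists i => //.
    by rewrite inE iA Xi; move/(subsetP Bprimes): pS; rewrite inE.
apply/consensus_closedP => U V /ZP[Uc UG] /ZP[Vc VG] valUV.
apply/ZP; split=> [|r rA Xr]; first exact: clAll.
have nonfreeP p : p \in Consensus (prime_implicants f) -> p \notin Free f ->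
    exists i, p = X i.
  move=> pc pF; have : p \in nonfree f by rewrite inE pF.
  by rewrite -Ximg => /imsetP[i _ ->]; exists i.
(* One-parent triples are never useless, so [i] is in [A] and [X i] with the free products yields
   [X r]. *)
have step i : (r, i, None) \in initial_table f X K ->
    (forall j, j \in A -> X j = X i -> X i \in G) -> X r \in G.
  move=> tT iG.
  have [|iA _] := @ancestor_set_parents K A r i None Aanc rA.
    by rewrite inE tT.
  apply: subsetP (initial_table_NoneP tT).
  by rewrite Consensus_subP subUset FG sub1set (iG i).
have [UF|UF] := boolP (U \in Free f); have [VF|VF] := boolP (V \in Free f).
- by apply/(subsetP FG)/clF.
- have [i Vi] := nonfreeP V Vc VF; rewrite -Xr; apply: (step i).
    rewrite inE; apply/orP; left; apply/exists_inP; exists U => //.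
    by rewrite -Vi valid_consensusC valUV consensusC Xr eqxx.
  by rewrite -Vi.
- have [i Ui] := nonfreeP U Uc UF; rewrite -Xr; apply: (step i).
    rewrite inE; apply/orP; left; apply/exists_inP; exists V => //.
    by rewrite -Ui valUV Xr eqxx.
  by rewrite -Ui.
have [i Ui] := nonfreeP U Uc UF; have [j Vj] := nonfreeP V Vc VF.
have tT : (r, i, Some j) \in initial_table f X K.
  by rewrite inE -Ui -Vj valUV Xr eqxx.
(* If a one-parent triple makes [(r, i, Some j)] useless, that triple is used instead; otherwise
   both parents are in [A]. *)
have [iT|iT] := boolP ((r, i, None) \in initial_table f X K).
  by rewrite -Xr; apply: (step i) => //; rewrite -Ui.
have [jT|jT] := boolP ((r, j, None) \in initial_table f X K).
  by rewrite -Xr; apply: (step j) => //; rewrite -Vj.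
have [|iA jA] := @ancestor_set_parents K A r i (Some j) Aanc rA.
  by rewrite inE tT iT.
by apply: clG => //; [apply: (UG i) | apply: (VG j) => //; apply: jA].
Qed.

Lemma primeset_primes A : primeset f X A \subset prime_implicants f.
Proof. by apply/subsetP => p /imsetP[i]; rewrite !inE => /andP[_ h] ->. Qed.

Lemma primeset_nonfree A p :
  nonfree_indexing f X -> p \in primeset f X A -> p \notin Free f.
Proof.
move=> [_ Ximg] /imsetP[i _ ->].
have : X i \in nonfree f by rewrite -Ximg imset_f.
by rewrite inE => /andP[].
Qed.

End TableTheory.

(** * Exchange arguments for minimum-cost bases *)

Section CostTheory.
Variables (n : nat) (R : realFieldType) (C : product n -> R).
Hypothesis C_gt0 : forall p, 0 < C p.
Implicit Types (P Q B : {set product n}).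

Lemma cost_split B P : cost C B = cost C (B :&: P) + cost C (B :\: P).
Proof. exact: big_setID. Qed.

Lemma cost_subset P Q : P \subset Q -> cost C P <= cost C Q.
Proof.
move=> /setIidPr PQ; rewrite (cost_split Q P) PQ lerDl.
by apply: sumr_ge0 => p _; apply: ltW.
Qed.

Lemma costU P Q : cost C (P :|: Q) <= cost C P + cost C Q.
Proof.
rewrite (cost_split _ P) setIUl setIid (setUidPl (subsetIr _ _)).
by rewrite lerD2l cost_subset // setDUl setDv set0U subsetDl.
Qed.

Variable f : point n -> bool.

(** [B :\: P :|: Q] is a basis. Its cost is only bounded by the sum, as [Q] may meet [B :\: P], but
    this bound suffices. *)
Lemma minimum_cost_basis_exchange B P Q :
  minimum_cost_basis C f B -> Q \subset prime_implicants f ->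
  B \subset Consensus (B :\: P :|: Q) -> cost C (B :&: P) <= cost C Q.
Proof.
move=> [Bbasis Bmin] Qprimes cov.
have B'basis : basis f (B :\: P :|: Q).
  apply: (basis_exchange Bbasis _ cov); rewrite subUset Qprimes andbT.
  exact: subset_trans (subsetDl _ _) Bbasis.1.
have := le_trans (Bmin _ B'basis) (costU _ _).
by rewrite (cost_split B P) addrC lerD2l.
Qed.

(** Exchange [p] for the empty set, which is strictly cheaper. *)
Lemma minimum_cost_basis_irredundant B p :
  minimum_cost_basis C f B -> p \in B -> p \notin Consensus (B :\ p).
Proof.
move=> Bmin pB; apply/negP => pcov.
have : cost C (B :&: [set p]) <= cost C set0.
  apply: minimum_cost_basis_exchange Bmin (sub0set _) _.
  rewrite setU0 -{1}(setD1K pB) subUset sub1set pcov.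
  exact: sub_Consensus.
have -> : B :&: [set p] = [set p] by apply/setIidPr; rewrite sub1set.
by rewrite /cost big_set1 big_set0 leNgt C_gt0.
Qed.

End CostTheory.

(** * Splitting a minimum-cost basis *)

Theorem theorem4p1 (n : nat) (f : point n -> bool)
  (R : realFieldType) (C : product n -> R) (C_gt0 : forall p, 0 < C p)
  (m : nat) (X : 'I_m -> product n) (X_index : nonfree_indexing f X)
  (K : {set 'I_m}) (K_prime : forall k, k \in K -> prime_implicant f (X k))
  (T : {set triple m}) (T_table : T = triples_table f X K)
  (A : {set 'I_m}) (A_anc : ancestor_set T A)
  (PS : {set product n}) (PS_def : PS = primeset f X A)
  (RS : {set product n})
  (RS_def : RS = prime_implicants f :\: Consensus (Essentials f :|: PS))
  (B : {set product n}) (B_min : minimum_cost_basis C f B) :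
  exists Q1 Q2 : {set product n},
    [/\ B = Essentials f :|: Q1 :|: Q2,
        minimum_cost_cover C (Free f) PS Q1 &
        minimum_cost_cover C (Consensus (Essentials f :|: PS)) RS Q2].
Proof.
have [Bbasis _] := B_min; have Bprimes := Bbasis.1.
have EB := Essentials_sub_basis Bbasis.
have primesB := basis_primes_covered Bbasis.
have PSprimes : PS \subset prime_implicants f.
  by rewrite PS_def primeset_primes.
have EPS p : p \in Essentials f -> p \notin PS.
  move/(subsetP (Essentials_free f)) => pF; rewrite PS_def.
  by apply/negP => /(primeset_nonfree X_index); rewrite pF.
set E := Essentials f in EB EPS RS_def *.
have covPS : PS \subset Consensus (Free f :|: B :&: PS).
  rewrite PS_def T_table in A_anc *.
  apply: subset_trans (Consensus_ancestor_set X_index A_anc Bprimes).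
  by rewrite subsetI subxx andbT (setUidPr EB) -PS_def (subset_trans PSprimes).
have freeE := Free_setU f; rewrite -/E in freeE; clearbody E.
have defB : B = E :|: B :&: PS :|: B :\: (E :|: PS).
  apply/setP => p; rewrite !inE.
  case pE: (p \in E); first by rewrite (subsetP EB).
  by case: (p \in B); case: (p \in PS).
have covEPS (S : {set product n}) : E :|: B :&: PS \subset S ->
    Consensus (E :|: PS) \subset Consensus S.
  move=> sS; rewrite Consensus_subP subUset; apply/andP; split.
    apply: subset_trans (sub_Consensus _).
    exact: subset_trans (subsetUl _ _) sS.
  by apply: subset_trans covPS _; rewrite freeE ConsensusS.
exists (B :&: PS), (B :\: (E :|: PS)); split=> //; split=> //.
- exact: subsetIr.
(* Essentials are free, hence outside [PS], so they survive in [B :\: PS] and together with [Q]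
   recover [PS]. *)
- move=> Q QPS covQ; apply: (minimum_cost_basis_exchange C_gt0 B_min).
    exact: subset_trans PSprimes.
  rewrite -{1}(setID B PS) subUset; apply/andP; split; last first.
    exact: subset_trans (subsetUl _ _) (sub_Consensus _).
  apply: subset_trans (subsetIr _ _) (subset_trans covQ _).
  rewrite freeE ConsensusS // setSU //; apply/subsetP => p pE.
  by rewrite inE EPS // (subsetP EB).
(* Were [p] covered by [E :|: PS], it would be covered by [E :|: B :&: PS], a part of [B :\ p]. *)
- apply/subsetP => p; rewrite !inE negb_or => /andP[/andP[pE pPS] pB].
  rewrite RS_def inE (subsetP Bprimes) // andbT.
  apply: contra (minimum_cost_basis_irredundant C_gt0 B_min pB).
  apply/subsetP/covEPS/subsetP => q; rewrite !inE => qS.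
  apply/andP; split; last by case/orP: qS => [/(subsetP EB)|/andP[]].
  by apply: contraTneq qS => ->; rewrite negb_or pE negb_and pPS orbT.
- rewrite /covers; apply: subset_trans (_ : _ \subset Consensus B) _.
    by rewrite RS_def (subset_trans _ primesB) ?subsetDl.
  apply: ConsensusS; rewrite {1}defB setSU //.
  apply: subset_trans (sub_Consensus _); apply: setUS; exact: subsetIr.
(* Exchanging on the complement of [E :|: PS] keeps [E] and [B :&: PS]. These cover [PS], and with
   [Q] also [RS]; every prime is in [RS] or covered by [E :|: PS]. *)
- move=> Q QRS covQ; rewrite setDE.
  apply: (minimum_cost_basis_exchange C_gt0 B_min).
    by apply: subset_trans QRS _; rewrite RS_def subsetDl.
  have sS : E :|: B :&: PS \subset B :\: ~: (E :|: PS) :|: Q.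
    apply/subsetP => p; rewrite !inE negbK.
    by case/orP => [pE|/andP[-> ->]]; rewrite ?orbT // pE (subsetP EB).
  have {}covEPS := covEPS _ sS.
  have covRS : RS \subset Consensus (B :\: ~: (E :|: PS) :|: Q).
    apply: subset_trans covQ _; rewrite Consensus_subP subUset covEPS.
    exact: subset_trans (subsetUr _ _) (sub_Consensus _).
  apply/subsetP => p pB.
  have [/(subsetP covEPS) //|pN] := boolP (p \in Consensus (E :|: PS)).
  by apply: (subsetP covRS); rewrite RS_def inE pN (subsetP Bprimes).
Qed.
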